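(* For all positive integers $k$ and $n$ with $k \geq 2$, we have $$\rho_k^n = 2^n - n\, 2^{n-k-1} \sum_{\ell=0}^{+\infty} \frac{1}{\ell+1} \binom{k(\ell+1)+\ell-n}{\ell} \frac{1}{2^{(k+1)\ell}} .$$ In particular, for every integer $k \geq 2$, $$\rho_k = 2 - \frac{1}{2^k} \sum_{\ell=0}^{+\infty} \frac{1}{\ell+1} \binom{k(\ell+1)+\ell-1}{\ell} \frac{1}{2^{(k+1)\ell}} .$$
   Context: For an integer $k \geq 2$, $\rho_k$ denotes the unique complex root of modulus greater than $1$ of the equation $x^k = x^{k-1} + x^{k-2} + \dots + x + 1$; it is known that this root exists and is unique, is real and lies in the interval $(1,2)$. For $a, b \in \mathbb{Z}$, the generalized binomial coefficient is defined by $\binom{a}{b} := \frac{a(a-1)\cdots(a-b+1)}{b!}$ if $b \geq 0$; $\binom{a}{b} := \binom{a}{a-b}$ if $b < 0$ and $a \geq b$; and $\binom{a}{b} := 0$ if $a < b < 0$. (In the formulas of the claim the lower entry is always nonnegative, while the upper entry may be negative.) *)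

(* Defs.v *)
From Stdlib Require Import Reals ZArith ClassicalEpsilon.
From Coquelicot Require Import Coquelicot.

Open Scope R_scope.

(* [sum_n] includes its upper bound. *)
Definition is_dominant_root (k : nat) (x : C) : Prop :=
  1 < Cmod x /\ (x ^ k)%C = sum_n (fun i => (x ^ i)%C) (k - 1).

(* Definite description: [RtoC 0] only witnesses that [C] is inhabited. *)
Definition rho (k : nat) : C :=
  epsilon (inhabits (RtoC 0)) (unique (is_dominant_root k)).

Fixpoint falling (a : Z) (b : nat) : Z :=
  match b with
  | O => 1
  | S b' => falling a b' * (a - Z.of_nat b')
  end%Z.

Definition binomial_nat (a : Z) (b : nat) : R := IZR (falling a b) / INR (fact b).

Definition binomial (a b : Z) : R :=
  if (0 <=? b)%Z then binomial_nat a (Z.to_nat b)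
  else if (b <=? a)%Z then binomial_nat a (Z.to_nat (a - b))
  else 0.

Definition summand (k n l : nat) : R :=
  / (INR l + 1) *
  binomial (Z.of_nat k * (Z.of_nat l + 1) + Z.of_nat l - Z.of_nat n) (Z.of_nat l) *
  / 2 ^ ((k + 1) * l).

(* Main.v *)
Require Import Defs.
From Stdlib Require Import Reals ZArith ClassicalEpsilon Lra Lia.
From Coquelicot Require Import Coquelicot.

Open Scope R_scope.

(** Multiplying the defining equation of [rho k] by [x - 1] turns it into
    [x ^ (k+1) = 2 * x ^ k - 1], and in terms of [w = 2 / x] this reads
    [w = 1 + z * w ^ t] with [t = k + 1] and [z = 1 / 2 ^ t].  Lagrange
    inversion predicts that the small solution satisfies
    [w ^ r = sum_l A_l(r) * z ^ l] for every integer [r], where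
    [A_l(r) = r / (t*l + r) * binomial (t*l + r) l].  For [r = -n] the term of
    index [l + 1] is [- n * z] times the summand of index [l] of the theorem, and
    multiplying by [2 ^ n] gives the claimed formula.

    The expansion is proved without any inversion theorem or product of series.
    The coefficients satisfy [A_(l+1)(r+1) = A_(l+1)(r) + A_l(r+t)]
    ([raney_recurrence]), which mirrors [w ^ (r+1) = w ^ r + z * w ^ (r+t)].
    Subtracting the two, the error [E_N(m)] of the [N]-th partial sum against
    [w ^ m], for [m] a natural number, obeys
    [E_(N+1)(m+1) = E_(N+1)(m) + z * E_N(m+t)] and [E_N(0) = 0].  If a radius
    [V >= |w|] satisfies [z * V ^ t <= lam * (V - 1)], a double induction gives
    [|E_N(m)| <= 2 * lam ^ N * V ^ m] ([raney_sum_error]).  With [V = 3/2] and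
    [lam = 27/32] this holds for all [t >= 3], so the partial sums converge.
    Negative exponents follow from the same recurrence read backwards
    ([raney_sum_lim]).

    The error bound is valid for complex [w], so it also shows that the equation
    has at most one solution of modulus at most [3/2] ([solution_unique]).  A root
    [x] with [|x| > 1] gives [|w| < 2], which already forces [|w| <= 3/2], and
    the intermediate value theorem supplies a real solution.  Hence [rho k] is
    well defined and equals [2 / w] for that real [w] ([rho_spec]). *)

(** * Raney coefficients and their recurrence *)

(** The Fuss-Catalan (Raney) numbers [r / (t*l + r) * binomial (t*l + r) l],
    with the factor [t*l + r] cancelled so that no division by zero can occur
    for negative [r]. *)
Definition raney (t : nat) (r : Z) (l : nat) : R :=
  match l with
  | O => 1
  | S m => IZR r * IZR (falling (Z.of_nat t * Z.of_nat l + r - 1) m) /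
           INR (fact l)
  end.

Lemma falling_head (a : Z) (b : nat) :
  falling a (S b) = (a * falling (a - 1) b)%Z.
Proof.
  induction b as [|b IH]; [cbn [falling]; lia|].
  change (falling a (S b) * (a - Z.of_nat (S b)) =
          a * (falling (a - 1) b * (a - 1 - Z.of_nat b)))%Z.
  rewrite IH. lia.
Qed.

(** With [b = t*(p+2) + r], all three products share the factor
    [falling (b-1) p], and what remains is
    [(r+1) * b - r * (b-1-p) = (p+2) * (r+t)]. *)
Lemma raney_recurrence (t : nat) (r : Z) (l : nat) :
  raney t (r + 1) (S l) = raney t r (S l) + raney t (r + Z.of_nat t) l.
Proof.
  destruct l as [|p].
  - unfold raney. rewrite plus_IZR. cbn. field.
  - unfold raney.
    set (b := (Z.of_nat t * Z.of_nat (S (S p)) + r)%Z).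
    replace (Z.of_nat t * Z.of_nat (S (S p)) + (r + 1) - 1)%Z with b by lia.
    replace (Z.of_nat t * Z.of_nat (S p) + (r + Z.of_nat t) - 1)%Z
      with (b - 1)%Z by lia.
    rewrite (falling_head b p).
    change (falling (b - 1) (S p))
      with (falling (b - 1) p * (b - 1 - Z.of_nat p))%Z.
    rewrite (fact_simpl (S p)), mult_INR.
    assert (Hb : IZR b = INR t * INR (S (S p)) + IZR r).
    { unfold b. now rewrite plus_IZR, mult_IZR, <- !INR_IZR_INZ. }
    rewrite !mult_IZR, !minus_IZR, !plus_IZR, <- !INR_IZR_INZ, Hb.
    pose proof (INR_fact_neq_0 (S p)). pose proof (pos_INR p).
    rewrite !S_INR. field. split; [assumption | lra].
Qed.

Definition raney_sum (t : nat) (z : R) (r : Z) (N : nat) : R :=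
  sum_n (fun l => raney t r l * z ^ l) N.

Lemma raney_sum_recurrence (t : nat) (z : R) (r : Z) (N : nat) :
  raney_sum t z (r + 1) (S N) =
  raney_sum t z r (S N) + z * raney_sum t z (r + Z.of_nat t) N.
Proof.
  unfold raney_sum.
  induction N as [|N IH].
  - rewrite !sum_Sn, !sum_O, raney_recurrence. unfold plus; cbn. ring.
  - rewrite sum_Sn, IH, raney_recurrence,
      (sum_Sn (fun l => raney t r l * z ^ l) (S N)),
      (sum_Sn (fun l => raney t (r + Z.of_nat t) l * z ^ l) N).
    unfold plus; cbn -[raney sum_n]. ring.
Qed.

Lemma raney_sum_zero (t : nat) (z : R) (N : nat) : raney_sum t z 0 N = 1.
Proof.
  unfold raney_sum. induction N as [|N IH].
  - rewrite sum_O. cbn. ring.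
  - rewrite sum_Sn, IH. unfold raney, plus; cbn -[fact].
    unfold Rdiv. ring.
Qed.

(** * Convergence to the powers of a small solution *)

(** The outer induction on [N] must treat all exponents [m] at once, because the
    recurrence trades one unit of precision for a jump from [m] to [m + t].  The
    hypothesis on [V] and [lam] is exactly what makes the bound propagate:
    [lam * V ^ m + z * V ^ (m+t) <= lam * V ^ (m+1)].  Bounding by powers of a [V]
    strictly larger than the solution is what leaves room for [lam < 1]. *)
Lemma raney_sum_error (t : nat) (z V lam : R) (w : C) :
  0 <= z -> 1 <= V -> 0 <= lam -> z * V ^ t <= lam * (V - 1) ->
  Cmod w <= V -> w = (1 + z * w ^ t)%C ->
  forall N m : nat,
  Cmod (raney_sum t z (Z.of_nat m) N - w ^ m)%C <= 2 * lam ^ N * V ^ m.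
Proof.
  intros Hz HV Hlam Hcontr Hw Heq N.
  induction N as [|N IHN].
  - intros m. unfold raney_sum. rewrite sum_O. cbn -[Cpow pow].
    replace (1 * z ^ 0) with 1 by (cbn; ring).
    unfold Cminus. eapply Rle_trans; [apply Cmod_triangle|].
    rewrite Cmod_opp, Cmod_1, Cmod_pow.
    assert (Cmod w ^ m <= V ^ m)
      by (apply pow_incr; split; [apply Cmod_ge_0 | assumption]).
    assert (1 <= V ^ m) by (now apply pow_R1_Rle).
    cbn [pow]. lra.
  - induction m as [|m IHm].
    + change (Z.of_nat 0) with 0%Z. rewrite raney_sum_zero.
      replace (1 - w ^ 0)%C with (RtoC 0) by (cbn; ring).
      rewrite Cmod_0. pose proof (pow_le lam (S N) Hlam). cbn [pow] in *. lra.
    + replace (Z.of_nat (S m)) with (Z.of_nat m + 1)%Z by lia.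
      rewrite raney_sum_recurrence.
      replace (Z.of_nat m + Z.of_nat t)%Z with (Z.of_nat (m + t)) by lia.
      assert (Hpow : (w ^ S m = w ^ m + z * w ^ (m + t))%C).
      { rewrite Cpow_S, Cpow_add_r. rewrite Heq at 1. ring. }
      rewrite Hpow, RtoC_plus, RtoC_mult.
      match goal with |- Cmod ?e <= _ => replace e with
        ((raney_sum t z (Z.of_nat m) (S N) - w ^ m) +
         z * (raney_sum t z (Z.of_nat (m + t)) N - w ^ (m + t)))%C by ring end.
      eapply Rle_trans; [apply Cmod_triangle|].
      rewrite Cmod_mult, Cmod_R, (Rabs_pos_eq z) by assumption.
      specialize (IHN (m + t)%nat).
      apply (Rmult_le_compat_l z) in IHN; [|assumption].
      rewrite pow_add in IHN.
      assert (0 <= lam ^ N * V ^ m)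
        by (apply Rmult_le_pos; apply pow_le; lra).
      cbn [pow] in *. nra.
Qed.

(** The partial sums at exponent 1 do not depend on the solution, yet converge to
    each solution of modulus at most [V]. *)
Lemma solution_unique (t : nat) (z V lam : R) (w w' : C) :
  0 <= z -> 1 <= V -> 0 <= lam < 1 -> z * V ^ t <= lam * (V - 1) ->
  Cmod w <= V -> w = (1 + z * w ^ t)%C ->
  Cmod w' <= V -> w' = (1 + z * w' ^ t)%C -> w = w'.
Proof.
  intros Hz HV Hlam Hcontr Hw Heq Hw' Heq'.
  apply Ceq_minus, Cmod_eq_0.
  apply Rle_antisym; [|apply Cmod_ge_0].
  apply (is_lim_seq_le (fun _ => Cmod (w - w')) (fun N => 4 * V * lam ^ N)
           (Cmod (w - w')) 0).
  - intros N.
    pose proof (raney_sum_error t z V lam w Hz HV (proj1 Hlam) Hcontr Hw Heq N 1) as H.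
    pose proof (raney_sum_error t z V lam w' Hz HV (proj1 Hlam) Hcontr Hw' Heq' N 1) as H'.
    rewrite Cpow_1_r in H, H'. rewrite <- Cmod_opp in H.
    set (P := RtoC (raney_sum t z (Z.of_nat 1) N)) in *.
    replace (w - w')%C with (- (P - w) + (P - w'))%C by ring.
    eapply Rle_trans; [apply Cmod_triangle|]. cbn [pow] in *. lra.
  - apply is_lim_seq_const.
  - replace (Finite 0) with (Rbar_mult (4 * V) 0) by (cbn; f_equal; ring).
    apply is_lim_seq_scal_l, is_lim_seq_geom. rewrite Rabs_pos_eq; lra.
Qed.

(** For negative [r], descend with
    [w ^ r = w ^ (r+1) - z * w ^ (r+t)], in which both exponents on the right
    exceed [r]; the partial sums satisfy the same relation. *)
Lemma raney_sum_lim (t : nat) (z V lam w : R) :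
  (1 <= t)%nat -> 0 <= z -> 1 <= V -> 0 <= lam < 1 -> z * V ^ t <= lam * (V - 1) ->
  0 < w <= V -> w = 1 + z * w ^ t ->
  forall r : Z, is_lim_seq (raney_sum t z r) (powerRZ w r).
Proof.
  intros Ht Hz HV Hlam Hcontr Hw Heq.
  assert (Hnonneg : forall m : nat,
            is_lim_seq (raney_sum t z (Z.of_nat m)) (powerRZ w (Z.of_nat m))).
  { intros m. rewrite <- pow_powerRZ.
    apply is_lim_seq_ext with (fun N => (raney_sum t z (Z.of_nat m) N - w ^ m) + w ^ m);
      [intros N; ring|].
    replace (Finite (w ^ m)) with (Finite (0 + w ^ m)) by (f_equal; ring).
    apply is_lim_seq_plus'; [|apply is_lim_seq_const].
    apply is_lim_seq_abs_0.
    apply is_lim_seq_le_le with (fun _ => 0) (fun N => 2 * V ^ m * lam ^ N).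
    - intros N. split; [apply Rabs_pos|].
      assert (HwC : Cmod w <= V) by (rewrite Cmod_R, Rabs_pos_eq; lra).
      assert (HeqC : RtoC w = (1 + z * w ^ t)%C)
        by (rewrite <- RtoC_pow, <- RtoC_mult, <- RtoC_plus; now f_equal).
      pose proof (raney_sum_error t z V lam w Hz HV (proj1 Hlam) Hcontr HwC HeqC N m) as H.
      rewrite <- RtoC_pow, <- RtoC_minus, Cmod_R in H. lra.
    - apply is_lim_seq_const.
    - replace (Finite 0) with (Rbar_mult (2 * V ^ m) 0) by (cbn; f_equal; ring).
      apply is_lim_seq_scal_l, is_lim_seq_geom. rewrite Rabs_pos_eq; lra. }
  assert (Hall : forall (n : nat) (r : Z), (- Z.of_nat n <= r)%Z ->
            is_lim_seq (raney_sum t z r) (powerRZ w r)).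
  { induction n as [|n IH]; intros r Hr.
    - rewrite <- (Z2Nat.id r) by lia. apply Hnonneg.
    - destruct (Z.le_gt_cases (- Z.of_nat n) r) as [Hle | Hgt]; [now apply IH|].
      assert (Hval : powerRZ w r =
              powerRZ w (r + 1) - z * powerRZ w (r + Z.of_nat t)).
      { rewrite !powerRZ_add by lra. rewrite <- pow_powerRZ, powerRZ_1.
        rewrite <- (Rmult_1_r (powerRZ w r)) at 1.
        replace 1 with (w - z * w ^ t) at 1 by lra. ring. }
      (* The recurrence lowers the truncation index, so it speaks of the shifted
         sequence. *)
      apply is_lim_seq_incr_1.
      apply is_lim_seq_ext with
        (fun N => raney_sum t z (r + 1) (S N) -
                  z * raney_sum t z (r + Z.of_nat t) N).
      { intros N. rewrite raney_sum_recurrence. ring. }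
      rewrite Hval. apply is_lim_seq_minus'.
      + apply (is_lim_seq_incr_1 (raney_sum t z (r + 1))), IH. lia.
      + apply (is_lim_seq_scal_l _ z (powerRZ w (r + Z.of_nat t))), IH. lia. }
  intros r. apply (Hall (Z.to_nat (- r))). lia.
Qed.

(** * The dominant root *)

Lemma geometric_sum (x : C) (n : nat) :
  ((x - 1) * sum_n (fun i => (x ^ i)%C) n = x ^ S n - 1)%C.
Proof.
  induction n as [|n IH].
  - rewrite sum_O. cbn. ring.
  - rewrite sum_Sn. unfold plus; cbn -[sum_n Cpow].
    rewrite Cmult_plus_distr_l, IH, !Cpow_S. ring.
Qed.

(** Multiplying by [x - 1], which is nonzero when [|x| > 1], sums the geometric
    progression; dividing [x ^ (k+1) = 2 * x ^ k - 1] by [x ^ (k+1)] gives the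
    equation for [2 / x]. *)
Lemma dominant_root_iff (k : nat) (x : C) :
  (1 <= k)%nat ->
  is_dominant_root k x <->
  1 < Cmod x /\ (2 / x = 1 + (/ 2 ^ (k + 1))%R * (2 / x) ^ (k + 1))%C.
Proof.
  intros Hk. unfold is_dominant_root.
  enough (H : 1 < Cmod x ->
     ((x ^ k)%C = sum_n (fun i => (x ^ i)%C) (k - 1) <->
      (2 / x = 1 + (/ 2 ^ (k + 1))%R * (2 / x) ^ (k + 1))%C)) by tauto.
  intros Hx.
  assert (Hx0 : x <> 0) by (apply Cmod_gt_0; lra).
  assert (Hx1 : (x - 1)%C <> 0).
  { apply Cminus_eq_contra. intros ->. rewrite Cmod_1 in Hx. lra. }
  pose proof (geometric_sum x (k - 1)) as Hsum.
  replace (S (k - 1)) with k in Hsum by lia.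
  assert (Hxk : (x ^ k)%C <> 0) by now apply Cpow_nz.
  assert (H2k : RtoC 2 <> 0) by (intros H; apply RtoC_inj in H; lra).
  pose proof (Cpow_nz 2 (k + 1) H2k) as H2p.
  assert (Hscaled : ((/ 2 ^ (k + 1))%R * (2 / x) ^ (k + 1) = / (x * x ^ k))%C).
  { unfold Cdiv. rewrite RtoC_inv, RtoC_pow, Cpow_mult_l, Cpow_inv
      by (auto; apply pow_nonzero; lra).
    rewrite <- Cpow_S. replace (S k) with (k + 1)%nat by lia.
    field. split; [now apply Cpow_nz | assumption]. }
  rewrite Hscaled. split; intros H.
  - rewrite <- H in Hsum.
    replace (2 / x)%C with (((2 * x ^ k) / (x * x ^ k))%C) by (field; auto).
    replace (2 * x ^ k)%C with (x * x ^ k + 1)%C.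
    2:{ replace (x * x ^ k)%C with ((x - 1) * x ^ k + x ^ k)%C by ring.
        rewrite Hsum. ring. }
    field; auto.
  - assert (E : ((x - 1) * x ^ k = x ^ k - 1)%C).
    { replace ((x - 1) * x ^ k)%C
        with (x * x ^ k * (1 + / (x * x ^ k)) - 1 - x ^ k)%C by (field; auto).
      rewrite <- H. field. auto. }
    rewrite <- Hsum in E.
    apply (f_equal (Cmult (/ (x - 1)))) in E.
    rewrite !Cmult_assoc, Cinv_l, !Cmult_1_l in E by assumption. exact E.
Qed.

Lemma pow_le_cube (t : nat) (s : R) :
  (3 <= t)%nat -> 0 <= s <= 1 -> s ^ t <= s ^ 3.
Proof.
  intros Ht Hs. replace t with (3 + (t - 3))%nat by lia.
  rewrite pow_add.
  assert (s ^ (t - 3) <= 1) by (rewrite <- (pow1 (t - 3)); apply pow_incr; lra).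
  assert (0 <= s ^ 3) by (apply pow_le; lra). nra.
Qed.

(** The value [3/2] lies strictly between the two positive solutions of
    [w = 1 + (w/2) ^ t], the larger being [w = 2], for every [t >= 3]; the worst
    case is [t = 3], where [(3/4) ^ 3 = 27/64]. *)
Lemma contraction_at_three_halves (t : nat) :
  (3 <= t)%nat -> / 2 ^ t * (3 / 2) ^ t <= 27 / 32 * (3 / 2 - 1).
Proof.
  intros Ht. rewrite <- pow_inv, <- Rpow_mult_distr.
  replace (/ 2 * (3 / 2)) with (3 / 4) by field.
  pose proof (pow_le_cube t (3 / 4) Ht ltac:(lra)). cbn [pow] in *. lra.
Qed.

(** With [s = |w| / 2 < 1], the triangle inequality gives
    [2 * s <= 1 + s ^ t <= 1 + s ^ 3], that is
    [0 <= (1 - s) * (1 - s - s ^ 2)], so [s] is at most [(sqrt 5 - 1) / 2],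
    which is below [3/4]. *)
Lemma solution_modulus_bound (t : nat) (w : C) :
  (3 <= t)%nat -> Cmod w < 2 -> w = (1 + (/ 2 ^ t)%R * w ^ t)%C ->
  Cmod w <= 3 / 2.
Proof.
  intros Ht Hw Heq.
  assert (Htri : Cmod w <= 1 + (Cmod w / 2) ^ t).
  { unfold Rdiv. rewrite Rpow_mult_distr, pow_inv.
    rewrite Heq at 1. eapply Rle_trans; [apply Cmod_triangle|].
    rewrite Cmod_1, Cmod_mult, Cmod_pow, Cmod_R, Rabs_pos_eq; [lra|].
    apply Rlt_le, Rinv_0_lt_compat, pow_lt; lra. }
  pose proof (Cmod_ge_0 w) as H0.
  pose proof (pow_le_cube t (Cmod w / 2) Ht ltac:(lra)) as Hcube.
  set (s := Cmod w / 2) in *.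
  replace (Cmod w) with (2 * s) in * by (unfold s; field).
  cbn [pow] in Hcube.
  assert (Hfac : 0 <= (1 - s) * (1 - s - s * s)) by nra.
  destruct (Rle_lt_dec (2 * s) (3 / 2)) as [|Hs]; [assumption|].
  assert (1 - s - s * s < 0) by nra. nra.
Qed.

Lemma solution_exists (t : nat) :
  (3 <= t)%nat -> exists w : R, 0 < w <= 3 / 2 /\ w = 1 + / 2 ^ t * w ^ t.
Proof.
  intros Ht.
  destruct (IVT_cor (fun w => 1 + / 2 ^ t * w ^ t - w) 0 (3 / 2)) as [w [Hw H0]].
  - apply derivable_continuous. reg.
  - lra.
  - pose proof (contraction_at_three_halves t Ht). cbn beta.
    rewrite (pow_i t) by lia. nra.
  - exists w. cbn beta in H0. split; [|lra]. split; [|lra].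
    destruct (Req_dec w 0) as [->|]; [|lra].
    rewrite (pow_i t) in H0 by lia. lra.
Qed.

Lemma rho_spec (k : nat) :
  (2 <= k)%nat ->
  exists w : R, 0 < w <= 3 / 2 /\ w = 1 + / 2 ^ (k + 1) * w ^ (k + 1) /\
                rho k = RtoC (2 / w).
Proof.
  intros Hk.
  assert (Ht : (3 <= k + 1)%nat) by lia.
  destruct (solution_exists (k + 1) Ht) as [w [Hw Heq]].
  exists w. split; [exact Hw|]. split; [exact Heq|].
  assert (HeqC : RtoC w = (1 + (/ 2 ^ (k + 1))%R * w ^ (k + 1))%C)
    by (rewrite <- RtoC_pow, <- RtoC_mult, <- RtoC_plus; now f_equal).
  assert (Hw0 : RtoC w <> 0) by (intros E; apply RtoC_inj in E; lra).
  assert (H20 : RtoC 2 <> 0) by (intros E; apply RtoC_inj in E; lra).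
  assert (Hunique : unique (is_dominant_root k) (RtoC (2 / w))).
  { split.
    - apply dominant_root_iff; [lia|]. split.
      + rewrite Cmod_R, Rabs_pos_eq.
        * apply (Rmult_lt_reg_r w); [lra|]. field_simplify; lra.
        * apply Rlt_le, Rdiv_lt_0_compat; lra.
      + rewrite RtoC_div by lra.
        replace (2 / (2 / w))%C with (RtoC w) by (field; auto).
        exact HeqC.
    - intros x Hx. apply dominant_root_iff in Hx; [|lia].
      destruct Hx as [Hx1 Hx].
      assert (Hx0 : x <> 0) by (apply Cmod_gt_0; lra).
      assert (Hmod : Cmod (2 / x) < 2).
      { rewrite Cmod_div, Cmod_R, Rabs_pos_eq by (auto; lra).
        apply (Rmult_lt_reg_r (Cmod x)); [lra|]. field_simplify; lra. }
      assert (E : RtoC w = (2 / x)%C).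
      { apply (solution_unique (k + 1) (/ 2 ^ (k + 1)) (3 / 2) (27 / 32));
          try lra; try assumption.
        - apply Rlt_le, Rinv_0_lt_compat, pow_lt; lra.
        - now apply contraction_at_three_halves.
        - rewrite Cmod_R, Rabs_pos_eq; lra.
        - now apply (solution_modulus_bound (k + 1)). }
      rewrite RtoC_div, E by lra. field. auto. }
  destruct (epsilon_spec (inhabits (RtoC 0)) (unique (is_dominant_root k))
              (ex_intro _ _ Hunique)) as [Hrho _].
  symmetry. now apply Hunique.
Qed.

(** * The series *)

(** At [r = -n] the upper entry [t*(l+1) + r - 1] of the Raney coefficient is
    [k*(l+1) + l - n], the one in the theorem. *)
Lemma raney_term_eq_summand (k n l : nat) :
  raney (k + 1) (- Z.of_nat n) (S l) * (/ 2 ^ (k + 1)) ^ S l =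
  - (INR n * / 2 ^ (k + 1)) * summand k n l.
Proof.
  unfold summand, Defs.binomial, raney.
  replace (0 <=? Z.of_nat l)%Z with true by (symmetry; apply Z.leb_le; lia).
  unfold binomial_nat. rewrite Nat2Z.id, pow_mult, fact_simpl, mult_INR, S_INR.
  replace (Z.of_nat (k + 1) * Z.of_nat (S l) + - Z.of_nat n - 1)%Z
    with (Z.of_nat k * (Z.of_nat l + 1) + Z.of_nat l - Z.of_nat n)%Z by lia.
  rewrite opp_IZR, <- INR_IZR_INZ, pow_inv.
  pose proof (INR_fact_neq_0 l). pose proof (pos_INR l).
  assert (2 ^ (k + 1) <> 0) by (apply pow_nonzero; lra).
  assert ((2 ^ (k + 1)) ^ l <> 0) by now apply pow_nonzero.
  cbn [pow]. field. repeat split; auto; lra.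
Qed.

Lemma rho_pow_series (k n : nat) :
  (2 <= k)%nat -> (1 <= n)%nat ->
  ex_series (summand k n) /\
  (rho k ^ n)%C =
    RtoC (2 ^ n - INR n * powerRZ 2 (Z.of_nat n - Z.of_nat k - 1) *
                  Series (summand k n)).
Proof.
  intros Hk Hn.
  destruct (rho_spec k Hk) as [w [Hw [Heq Hrho]]].
  set (z := / 2 ^ (k + 1)) in *.
  assert (Hz : 0 < z) by (apply Rinv_0_lt_compat, pow_lt; lra).
  assert (Hn0 : 0 < INR n) by (apply lt_0_INR; lia).
  assert (Hraney : is_series (fun l => raney (k + 1) (- Z.of_nat n) l * z ^ l)
                             (/ w ^ n)).
  { rewrite pow_powerRZ, <- powerRZ_neg'.
    apply (raney_sum_lim (k + 1) z (3 / 2) (27 / 32) w); try lra; try lia.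
    apply contraction_at_three_halves. lia. }
  assert (Hsummand : is_series (summand k n) ((1 - / w ^ n) / (INR n * z))).
  { apply (is_series_ext (fun l => scal (- / (INR n * z))
             (raney (k + 1) (- Z.of_nat n) (S l) * z ^ S l))).
    - intros l. unfold z at 2. rewrite raney_term_eq_summand. fold z.
      unfold scal; cbn. unfold mult; cbn. field. lra.
    - replace ((1 - / w ^ n) / (INR n * z))
        with (scal (- / (INR n * z)) (/ w ^ n - 1))
        by (unfold scal; cbn; unfold mult; cbn; field; split; [apply pow_nonzero|]; lra).
      apply (@is_series_scal_l R_AbsRing R_NormedModule).
      apply (is_series_incr_1 (fun l => raney (k + 1) (- Z.of_nat n) l * z ^ l)).
      replace (plus _ _) with (/ w ^ n); [exact Hraney|].
      unfold plus; cbn. ring. }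
  split; [exact (ex_intro _ _ Hsummand)|].
  rewrite (is_series_unique _ _ Hsummand), Hrho, <- RtoC_pow. f_equal.
  assert (Hpow : powerRZ 2 (Z.of_nat n - Z.of_nat k - 1) = 2 ^ n * z).
  { replace (Z.of_nat n - Z.of_nat k - 1)%Z
      with (Z.of_nat n + - Z.of_nat (k + 1))%Z by lia.
    now rewrite powerRZ_add, powerRZ_neg', <- !pow_powerRZ by lra. }
  rewrite Hpow. unfold Rdiv at 1. rewrite Rpow_mult_distr, pow_inv.
  field. split; [apply pow_nonzero|]; lra.
Qed.

Theorem theorem3p1 :
  (forall k n : nat, (2 <= k)%nat -> (1 <= n)%nat ->
     ex_series (summand k n) /\
     (rho k ^ n)%C =
       RtoC (2 ^ n - INR n * powerRZ 2 (Z.of_nat n - Z.of_nat k - 1) *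
                     Series (summand k n))) /\
  (forall k : nat, (2 <= k)%nat ->
     ex_series (summand k 1) /\
     rho k = RtoC (2 - / 2 ^ k * Series (summand k 1))).
Proof.
  split; [exact rho_pow_series|].
  intros k Hk. destruct (rho_pow_series k 1 Hk (le_n 1)) as [Hex Hrho].
  split; [exact Hex|].
  rewrite Cpow_1_r in Hrho. rewrite Hrho. do 2 f_equal.
  - ring.
  - replace (Z.of_nat 1 - Z.of_nat k - 1)%Z with (- Z.of_nat k)%Z by lia.
    rewrite powerRZ_neg', <- pow_powerRZ. cbn [INR]. ring.
Qed.
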